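(* Suppose that $\lambda(X)\unlhd d^T(X)$ holds for every finite simple graph $X$. Then for every finite simple graph $G=(V,E)$ and every subset $D\subseteq V$ one has $$s(E,D)\unlhd d^T(E,D).$$
   Context: For a finite simple graph $X$ with $n$ vertices $v_1,\dots,v_n$, the combinatorial Laplacian $L(X)$ is the $n\times n$ matrix with $L(X)_{ii}=\deg(v_i)$, $L(X)_{ij}=-1$ if $\{v_i,v_j\}$ is an edge, and $L(X)_{ij}=0$ otherwise. It is positive semidefinite, and $\lambda(X)$ denotes its eigenvalues listed in non-increasing order with multiplicity. The conjugate degree sequence $d^T(X)$ is given by $d^T_j(X)=|\{v : \deg_X(v)\ge j\}|$ for $j\ge 1$. Relative (edge, vertex) pairs: for a finite simple graph $G=(V,E)$ and a set $D\subseteq V$ of ''deleted'' vertices, the relative (Dirichlet) Laplacian $L(E,D)$ is the principal submatrix of $L(G)$ with rows and columns indexed by $V\setminus D$ (degrees on the diagonal are the degrees in $G$). The sequence $s(E,D)$ consists of the eigenvalues of $L(E,D)$ in non-increasing order with multiplicity. For every $v\in V$ (including $v\in D$), the relative degree $d_v(E,D)$ is the number of edges $e\in E$ containing $v$ whose other endpoint lies in $V\setminus D$. The degree sequence $d(E,D)$ is the list of the $d_v(E,D)$, $v\in V$, in non-increasing order, and its conjugate is $d^T_j(E,D)=|\{v\in V : d_v(E,D)\ge j\}|$ for $j\ge1$. Trailing zeros may be added to or dropped from sequences as needed, so that sequences being compared have a common length. For non-increasing real sequences $s,t$ of length $n$, $s\unlhd t$ (''$s$ is majorized by $t$'') means $\sum_{i=1}^k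 s_i\le\sum_{i=1}^k t_i$ for all $k\le n$, and $\sum_{i=1}^n s_i=\sum_{i=1}^n t_i$. *)

(* Defs.v *)
From HB Require Import structures.
From mathcomp Require Import all_boot all_order all_algebra.
From mathcomp Require Import polyrcf complex reals.
Set Implicit Arguments.
Unset Strict Implicit.
Unset Printing Implicit Defensive.
Import Order.TTheory GRing.Theory Num.Theory.
Local Open Scope ring_scope.

Record sgraph := SGraph {
  vertex :> finType;
  adj : rel vertex;
  adj_sym : symmetric adj;
  adj_irr : irreflexive adj }.

Definition deg (X : sgraph) (v : X) : nat := #|[set u | adj v u]|.

(* Only the other endpoint [u] has to avoid [D]; [v] may itself lie in [D]. *)
Definition rel_deg (G : sgraph) (D : {set G}) (v : G) : nat :=
  #|[set u in ~: D | adj v u]|.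

(* Entry [j] (counted from 1) is the number of [v] with [f v >= j].  The list  *)
(* stops at j = #|T|: for the functions [deg] and [rel_deg], which are bounded *)
(* by #|T|, all later entries are zero.                                        *)
Definition conj_seq (T : finType) (f : T -> nat) : seq nat :=
  [seq #|[set v | j <= f v]%N| | j <- iota 1 #|T|].

Section Real.
Variable R : realType.

Definition laplacian (X : sgraph) : 'M[R]_#|X| :=
  \matrix_(i, j) (if i == j then (deg (enum_val i))%:R
                  else if adj (enum_val i) (enum_val j) then -1 else 0).

Definition rel_laplacian (G : sgraph) (D : {set G}) : 'M[R]_#|~: D| :=
  let f (i : 'I_#|~: D|) := enum_rank (enum_val i) in mxsub f f (laplacian G).

(* The real eigenvalues in non-increasing order, each repeated according to   *)
(* its multiplicity as a root of the characteristic polynomial; for symmetric *)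
(* matrices these are all the eigenvalues, by [char_poly_eigenvalues] below.  *)
Definition eigenvalues n (A : 'M[R]_n) : seq R :=
  sort >=%R (flatten [seq nseq (mup x (char_poly A)) x
                     | x <- rootsR (char_poly A)]).

(* Sequences of different lengths are padded with zeros: this is the effect   *)
(* of the default value in s`_i.                                              *)
Definition majorized (s t : seq R) : Prop :=
  let n := maxn (size s) (size t) in
  (forall k, (k <= n)%N -> \sum_(i < k) s`_i <= \sum_(i < k) t`_i) /\
  \sum_(i < n) s`_i = \sum_(i < n) t`_i.

Definition to_real (s : seq nat) : seq R := [seq m%:R | m <- s].

Lemma sorted_eigenvalues n (A : 'M[R]_n) : sorted >=%R (eigenvalues A).
Proof. by apply: sort_sorted => x y; rewrite /= le_total. Qed.

Lemma perm_eigenvalues n (A : 'M[R]_n) (s : seq R) :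
  char_poly A = \prod_(x <- s) ('X - x%:P) -> perm_eq (eigenvalues A) s.
Proof.
move=> As; rewrite /eigenvalues perm_sort.
have p0 : char_poly A != 0 by rewrite monic_neq0 ?char_poly_monic.
apply/allP => x _ /=; rewrite -(mu_prod_XsubC x s) -As count_flatten -map_comp.
set p := char_poly A in p0 *; rewrite (eq_map (g := fun y => (y == x) * mup x p)%N);
  last by move=> y /=; rewrite count_nseq /=; case: eqVneq => // ->.
have us : uniq (rootsR p) by apply: (sorted_uniq lt_trans ltxx); apply: sorted_roots.
rewrite sumnE big_map; apply/eqP.
have [px|px] := boolP (root p x); last first.
  by rewrite mupNroot // big1 // => y _; rewrite muln0.
have xp : x \in rootsR p.
  by have := roots_on_rootsR p0 x; rewrite in_itv /= px.
rewrite (bigD1_seq x) //= eqxx mul1n big1 ?addn0 // => y /negPf ->.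
by rewrite mul0n.
Qed.

Lemma char_poly_eigenvalues n (A : 'M[R]_n) : A^T = A ->
  char_poly A = \prod_(x <- eigenvalues A) ('X - x%:P).
Proof.
move=> Asym; pose B := map_mx (real_complex R) A.
have Bherm : B \is hermsymmx.
  apply: realsym_hermsym.
    apply/is_hermitianmxP.
    by rewrite expr0 scale1r map_mx_id // map_trmx Asym.
  apply/mxOverP => i j; rewrite mxE; by apply/complex_realP; exists (A i j).
have /orthomx_spectralP eqB := hermitian_normalmx Bherm.
have /mxOverP dreal := hermitian_spectral_diag_real Bherm.
set P := spectralmx B in eqB; set d := spectral_diag B in eqB dreal.
have uP : P \in unitmx by apply: spectral_unit.
pose r i := complex.Re (d 0 i).
have dE i : d 0 i = real_complex R (r i) by rewrite RRe_real ?dreal.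
have chB : char_poly B = \prod_(i < n) ('X - (d 0 i)%:P).
  have -> : char_poly B = char_poly (diag_mx d).
    rewrite /char_poly; set Q := map_mx polyC P.
    have uQ : Q \in unitmx by rewrite map_unitmx.
    have -> : char_poly_mx B = invmx Q *m char_poly_mx (diag_mx d) *m Q.
      rewrite /char_poly_mx mulmxBr mulmxBl scalar_mxC -(mulmxA 'X%:M) mulVmx //.
      by rewrite mulmx1 {1}eqB !map_mxM map_invmx.
    by rewrite !det_mulmx mulrAC -det_mulmx mulVmx // det1 mul1r.
  rewrite char_poly_trig ?diag_mx_is_trig //.
  by apply: eq_bigr => i _; rewrite mxE eqxx.
have chA : char_poly A = \prod_(x <- [seq r i | i : 'I_n]) ('X - x%:P).
  apply: (map_poly_inj (real_complex R)).
  rewrite map_char_poly -/B chB rmorph_prod /= big_image /=.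
  by apply: eq_bigr => i _; rewrite rmorphB /= map_polyX map_polyC /= dE.
by rewrite (perm_big _ (perm_eigenvalues chA)).
Qed.

End Real.

(* Main.v *)
(* With U the complement of D, L(E,D) is the Laplacian of G[U] plus, for each *)
(* deleted w, the diagonal 0/1 matrix of its neighbourhood N(w) in U.  By Ky  *)
(* Fan, the sum of the k largest eigenvalues is the trace of a compression to *)
(* k orthonormal vectors.  On that compression the first summand is bounded   *)
(* by the k largest Laplacian eigenvalues of G[U], hence by the conjugate     *)
(* degree sequence of G[U], and the summand of w by min(k, |N(w)|), which is  *)
(* the sum of the first k terms of the conjugate of the one degree |N(w)|.    *)
Require Import Defs.
From mathcomp Require Import all_boot all_order all_algebra.
From mathcomp Require Import reals.
From mathcomp Require Import perm complex ring zify.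

Set Implicit Arguments.
Unset Strict Implicit.
Unset Printing Implicit Defensive.
Import Order.TTheory GRing.Theory Num.Theory.
Local Open Scope ring_scope.
Local Open Scope sesquilinear_scope.
Local Open Scope complex_scope.

(** Conjugate degrees split the way the matrices do: by [sum_conj_seq] and [sum_minn_rel_deg], the
    first k terms for [rel_deg D] add up to those for [undeleted] plus the sum over deleted w of
    min(k, |N(w)|). Hence [sum_eigenvalues_rel_le] and the hypothesis for [undeleted] settle every k
    up to |U|, where U is the complement of D. Beyond |U| the spectral side is constant and the
    degree side cannot decrease. The totals agree since the trace and the relative degrees both
    count adjacent pairs (u, v) with u in U. *)

Lemma sum_mul_le_sum_top (F : numDomainType) (n k : nat) (d : nat -> F)
    (w : 'I_n -> F) :
  (k <= n)%N -> (forall i j, (i <= j < n)%N -> d j <= d i) ->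
  (forall j, 0 <= w j <= 1) -> \sum_j w j = k%:R ->
  \sum_(j < n) d j * w j <= \sum_(j < k) d j.
Proof.
(* c separates the k largest values of d from the others, so every term of    *)
(* the rewritten difference is a product of two factors of the same sign.     *)
move=> kn dmono w01 wk; rewrite -subr_ge0 (big_ord_widen n) //.
(* Both sets of weights have total k, so subtracting any constant changes nothing. For k = 0 this is
   [d 0], still an upper bound of all values. *)
pose c := d k.-1.
have -> : \sum_(j < n | (j < k)%N) d j - \sum_(j < n) d j * w j
        = \sum_(j < n) ((j < k)%:R - w j) * (d j - c).
  transitivity (\sum_(j < n) ((j < k)%:R * d j - d j * w j)
                - c * \sum_(j < n) ((j < k)%:R - w j)).
    rewrite !sumrB wk -natr_sum -big_mkcond -(big_ord_widen n (fun=> 1%N)) //.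
    rewrite sum1_card card_ord subrr mulr0 subr0 big_mkcond /=.
    by congr (_ - _); apply: eq_bigr => j _; case: ltnP; rewrite ?mul1r ?mul0r.
  by rewrite mulr_sumr -sumrB; apply: eq_bigr => j _; ring.
apply: sumr_ge0 => j _; have /andP[w0 w1] := w01 j.
case: ltnP => jk.
  by rewrite mulr_ge0 ?subr_ge0 // dmono //; lia.
rewrite sub0r mulNr -mulrN opprB mulr_ge0 ?subr_ge0 // dmono //.
by rewrite ltn_ord andbT (leq_trans (leq_pred k)).
Qed.

(** * Gram matrices of orthonormal rows *)

Section Gram.
Variable C : numClosedFieldType.

Lemma gram_diag_ge0 k n (W : 'M[C]_(k, n)) j : 0 <= (W^t* *m W) j j.
Proof.
rewrite mxE; apply: sumr_ge0 => i _.
by rewrite !mxE mulrC mul_conjC_ge0.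
Qed.

Lemma gram_diag_le1 k n (W : 'M[C]_(k, n)) j :
  W \is unitarymx -> (W^t* *m W) j j <= 1.
Proof.
(* The Gram matrix M is a Hermitian projector, so M_jj is the squared norm of *)
(* row j, which is at least M_jj ^ 2.                                         *)
move=> /unitarymxP WW; set M := W^t* *m W.
have M0 : 0 <= M j j := gram_diag_ge0 W j.
have MM : M *m M^t* = M.
  have -> : M^t* = M by rewrite /M trmx_mul map_mxM /= trmxCK.
  by rewrite /M mulmxA -(mulmxA _ W) WW mulmx1.
clearbody M; have : (M j j) ^+ 2 <= M j j.
  rewrite -[in leRHS]MM mxE (bigD1 j) //= !mxE -normCK.
  rewrite ger0_norm // lerDl sumr_ge0 // => i _.
  by rewrite !mxE mul_conjC_ge0.
have /orP[//|M1] : (M j j <= 1) || (1 <= M j j).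
  by rewrite real_leVge ?ger0_real.
by rewrite expr2 ger_pMl // (lt_le_trans ltr01).
Qed.

Lemma sum_gram_diag k n (W : 'M[C]_(k, n)) :
  W \is unitarymx -> \sum_j (W^t* *m W) j j = k%:R.
Proof.
by move=> /unitarymxP WW; rewrite -/(mxtrace _) mxtrace_mulC WW mxtrace1.
Qed.

(** For unitary [W] the weights on the right lie in [0, 1] and have total k. *)
Lemma mxtrace_mul_diag k n (W : 'M[C]_(k, n)) (d : 'rV_n) :
  \tr (W *m diag_mx d *m W^t*) = \sum_j d 0 j * (W^t* *m W) j j.
Proof.
rewrite mxtrace_mulC mulmxA; apply: eq_bigr => j _.
by rewrite mul_mx_diag !mxE mulrC.
Qed.

Lemma leq_unitarymx k n (W : 'M[C]_(k, n)) : W \is unitarymx -> (k <= n)%N.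
Proof. by move=> uW; rewrite -(mxrank_unitary uW) rank_leq_col. Qed.

Lemma char_poly_conj_unitary n (P A : 'M[C]_n) :
  P \is unitarymx -> char_poly (P^t* *m A *m P) = char_poly A.
Proof.
move=> uP; rewrite /char_poly.
have uQ : map_mx polyC P \in unitmx by rewrite map_unitmx unitarymx_unit.
rewrite -invmx_unitary //.
have -> : char_poly_mx (invmx P *m A *m P) =
   invmx (map_mx polyC P) *m char_poly_mx A *m map_mx polyC P.
  rewrite /char_poly_mx mulmxBr mulmxBl scalar_mxC -(mulmxA 'X%:M) mulVmx //.
  by rewrite mulmx1 !map_mxM map_invmx.
by rewrite !det_mulmx mulrAC -det_mulmx mulVmx // det1 mul1r.
Qed.

End Gram.

(** * Ky Fan's principle and sums of conjugate sequences *)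

Section KyFan.
Variable R : realType.
Local Notation toC := (real_complex R).

Lemma size_eigenvalues n (A : 'M[R]_n) : A^T = A -> size (eigenvalues A) = n.
Proof.
move=> /char_poly_eigenvalues /(congr1 (size \o val)) /=.
by rewrite size_char_poly size_prod_XsubC => -[].
Qed.

Lemma eigenvalues_noninc n (A : 'M[R]_n) i j : A^T = A ->
  (i <= j < n)%N -> (eigenvalues A)`_j <= (eigenvalues A)`_i.
Proof.
move=> sA /andP[ij jn].
have ge_trans : transitive (fun x y : R => x >= y).
  by move=> x y z xy yz; apply: le_trans yz xy.
have := sorted_leq_nth ge_trans (fun x => lexx x) 0 (sorted_eigenvalues A).
by apply; rewrite ?inE ?size_eigenvalues // (leq_ltn_trans ij).
Qed.

(** The spectral theorem diagonalizes in an unspecified order; equal characteristic polynomials give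
    a permutation to the sorted list, and permuting the rows of [P] by it restores the order. *)
Lemma spectral_eigenvalues n (A : 'M[R]_n) : A^T = A ->
  exists2 P : 'M[R[i]]_n, P \is unitarymx &
    map_mx toC A =
      P^t* *m diag_mx (\row_(i < n) ((eigenvalues A)`_i)%:C) *m P.
Proof.
move=> sA; pose B := map_mx toC A.
have Bherm : B \is hermsymmx.
  apply: realsym_hermsym.
    apply/is_hermitianmxP.
    by rewrite expr0 scale1r map_mx_id // map_trmx sA.
  by apply/mxOverP => i j; rewrite mxE; apply/complex_realP; exists (A i j).
have /orthomx_spectralP := hermitian_normalmx Bherm.
have := spectral_unitarymx B.
move: (spectralmx B) (spectral_diag B) => P d uP.
rewrite invmx_unitary // => eqB.
have chB : char_poly B = \prod_(x <- [tuple d 0 i | i < n]) ('X - x%:P).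
  rewrite eqB char_poly_conj_unitary // char_poly_trig ?diag_mx_is_trig //.
  by rewrite big_map big_enum /=; apply: eq_bigr => i _; rewrite mxE eqxx.
have chA : char_poly B = \prod_(x <- map toC (eigenvalues A)) ('X - x%:P).
  by rewrite -map_char_poly char_poly_eigenvalues // map_prod_XsubC big_map.
have : perm_eq (map toC (eigenvalues A)) [tuple d 0 i | i < n].
  by apply: prod_XsubC_eq; rewrite -chA chB.
case/tuple_permP => p pE.
have dE (i : 'I_n) : ((eigenvalues A)`_i)%:C = d 0 (p i).
  rewrite -(nth_map _ 0 toC) ?size_eigenvalues // pE.
  by rewrite -tnth_nth !tnth_mktuple.
exists (row_perm p P).
  apply/unitarymxP; move/unitarymxP: uP => PP.
  by apply/matrixP => i j; have := congr1 (fun M : 'M_n => M (p i) (p j)) PP;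
     rewrite !mxE (inj_eq perm_inj) => <-; apply: eq_bigr => l _; rewrite !mxE.
rewrite -/B eqB; apply/matrixP => i j; rewrite !mul_mx_diag !mxE.
rewrite (reindex_inj (@perm_inj _ p)); apply: eq_bigr => l _ /=.
by rewrite !mxE dE.
Qed.

Lemma ky_fan_le n k (A : 'M[R]_n) (W : 'M[R[i]]_(k, n)) :
  A^T = A -> W \is unitarymx ->
  \tr (W *m map_mx toC A *m W^t*) <= (\sum_(i < k) (eigenvalues A)`_i)%:C.
Proof.
move=> sA uW; have [P uP ->] := spectral_eigenvalues sA.
have uPt : P^t* \is unitarymx by rewrite trmxC_unitary.
have uV := mul_unitarymx uW uPt; set V := W *m P^t* in uV.
have -> M : W *m (P^t* *m M *m P) *m W^t* = V *m M *m V^t*.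
  by rewrite /V trmx_mul map_mxM /= trmxCK !mulmxA.
rewrite mxtrace_mul_diag rmorph_sum /=.
under eq_bigr do rewrite mxE.
apply: (sum_mul_le_sum_top (d := fun i => ((eigenvalues A)`_i)%:C)).
- exact: leq_unitarymx uW.
- by move=> i j ij; rewrite lecR eigenvalues_noninc.
- by move=> j; rewrite gram_diag_ge0 gram_diag_le1.
- exact: sum_gram_diag.
Qed.

Lemma ky_fan_eq n k (A : 'M[R]_n) : A^T = A -> (k <= n)%N ->
  exists2 W : 'M[R[i]]_(k, n), W \is unitarymx &
  \tr (W *m map_mx toC A *m W^t*) = (\sum_(i < k) (eigenvalues A)`_i)%:C.
Proof.
move=> sA kn; have [P uP AE] := spectral_eigenvalues sA.
have PP := unitarymxP uP.
(* [E] selects the first k rows of [P], which diagonalize [A] at its k largest eigenvalues. *)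
pose f := widen_ord kn; pose E : 'M[R[i]]_(k, n) := rowsub f 1%:M.
have uE : E \is unitarymx.
  apply/unitarymxP/matrixP => i j.
  rewrite !mxE (bigD1 (f i)) //= big1 => [|l li].
    by rewrite !mxE eqxx mul1r addr0 rmorph_nat eq_sym.
  by rewrite !mxE eq_sym (negPf li) mul0r.
exists (E *m P); first exact: mul_unitarymx.
rewrite AE trmx_mul map_mxM /= !mulmxA -(mulmxA E) PP mulmx1.
rewrite -(mulmxA _ P) PP mulmx1 rmorph_sum; apply: eq_bigr => i _.
rewrite mul_mx_diag !mxE (bigD1 (f i)) //= big1 => [|l li].
  by rewrite !mxE eqxx mul1r rmorph1 mulr1 addr0.
by rewrite !mxE eq_sym (negPf li) !mul0r.
Qed.

Lemma sum_eigenvalues n (A : 'M[R]_n) : A^T = A ->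
  \sum_(i < n) (eigenvalues A)`_i = \tr A.
Proof.
move=> sA; apply: complexI.
have [W uW <-] := ky_fan_eq sA (leqnn n).
have := unitarymxP uW; rewrite mxtrace_mulC mulmxA => /mulmx1C ->.
by rewrite mul1mx trace_map_mx.
Qed.

(** Double counting: among the first k entries, [v] is counted in those numbered 1 to min(k,
    [f v]). *)
Lemma sum_conj_seq (T : finType) (f : T -> nat) k : (k <= #|T|)%N ->
  \sum_(i < k) (to_real R (conj_seq f))`_i = (\sum_v minn k (f v))%N%:R.
Proof.
move=> kT; rewrite /to_real /conj_seq.
have sz : size (iota 1 #|T|) = #|T| by rewrite size_iota.
transitivity ((\sum_(i < k) \sum_v (i < f v))%N%:R : R).
  rewrite natr_sum; apply: eq_bigr => i _; have iT := leq_trans (ltn_ord i) kT.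
  rewrite (nth_map 0%N) ?size_map ?sz // (nth_map 0%N) ?sz //.
  rewrite nth_iota // add1n -sum1dep_card big_mkcond /=.
  by congr (_%:R); apply: eq_bigr => v _; case: ifP.
rewrite exchange_big /=; congr (_%:R); apply: eq_bigr => v _.
elim: k {kT} => [|k IH]; first by rewrite big_ord0 min0n.
by rewrite big_ord_recr /= IH; lia.
Qed.

End KyFan.

(** * Splitting the relative Laplacian *)

Section Relative.
Variables (R : realType) (G : sgraph) (D : {set G}).
Local Notation toC := (real_complex R).

Definition undeleted_adj : rel G :=
  fun u v => [&& u \notin D, v \notin D & adj u v].

Lemma undeleted_adj_sym : symmetric undeleted_adj.
Proof. by move=> u v; rewrite /undeleted_adj adj_sym andbCA. Qed.

Lemma undeleted_adj_irr : irreflexive undeleted_adj.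
Proof. by move=> u; rewrite /undeleted_adj adj_irr !andbF. Qed.

(* The deleted vertices are kept as isolated ones, so that this graph has the *)
(* same vertex type as G.                                                     *)
Definition undeleted : sgraph := SGraph undeleted_adj_sym undeleted_adj_irr.

(** Its cardinality is [rel_deg D w] by definition. *)
Definition deleted_nbhd (w : G) : {set G} := [set u in ~: D | adj w u].

Definition deleted_deg (u : G) : nat :=
  (\sum_(w in D) (u \in deleted_nbhd w))%N.

Definition undeleted_index (i : 'I_#|~: D|) : 'I_#|G| := enum_rank (enum_val i).

Lemma undeleted_index_inj : injective undeleted_index.
Proof. by move=> i j /enum_rank_inj /enum_val_inj. Qed.

Lemma enum_val_notin (i : 'I_#|~: D|) : enum_val i \notin D.
Proof. by have := enum_valP i; rewrite inE. Qed.

Lemma rel_deg_undeleted (v : G) : v \notin D ->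
  rel_deg D v = deg (v : undeleted).
Proof.
by move=> vD; apply: eq_card => u; rewrite !inE /adj /= /undeleted_adj vD.
Qed.

Lemma deg_undeleted_deleted (v : G) : v \in D -> deg (v : undeleted) = 0%N.
Proof.
by move=> vD; apply: eq_card0 => u; rewrite !inE /adj /= /undeleted_adj vD.
Qed.

Lemma deg_split (u : G) : u \notin D ->
  deg u = (deg (u : undeleted) + deleted_deg u)%N.
Proof.
move=> uD; rewrite -rel_deg_undeleted // /deg /rel_deg /deleted_deg.
rewrite -(cardsID D) addnC; congr (_ + _)%N.
  by apply: eq_card => v; rewrite !inE.
rewrite -sum1_card [LHS]big_mkcond [RHS]big_mkcond; apply: eq_bigr => w _.
by rewrite !inE uD adj_sym; case: (w \in D); case: (adj w u).
Qed.

Lemma sum_deg_undeleted :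
  (\sum_(u | u \notin D) deg u = \sum_v rel_deg D v)%N.
Proof.
transitivity (\sum_(u | u \notin D) \sum_v adj u v)%N.
  apply: eq_bigr => u _; rewrite /deg -sum1dep_card [LHS]big_mkcond.
  by apply: eq_bigr => v _; case: adj.
rewrite exchange_big; apply: eq_bigr => v _.
rewrite /rel_deg -sum1dep_card [LHS]big_mkcond [RHS]big_mkcond.
by apply: eq_bigr => u _; rewrite inE adj_sym; case: (u \in D); case: adj.
Qed.

Lemma sum_minn_rel_deg k :
  (\sum_v minn k (rel_deg D v) =
   \sum_v minn k (deg (v : undeleted)) +
   \sum_(w in D) minn k #|deleted_nbhd w|)%N.
Proof.
rewrite [X in (_ + X)%N]big_mkcond -big_split; apply: eq_bigr => v _ /=.
case: (boolP (v \in D)) => vD.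
  by rewrite deg_undeleted_deleted // minn0.
by rewrite rel_deg_undeleted // addn0.
Qed.

Lemma laplacian_sym (X : sgraph) : (laplacian R X)^T = laplacian R X.
Proof.
by apply/matrixP => i j; rewrite !mxE eq_sym adj_sym; case: eqVneq => // ->.
Qed.

Lemma rel_laplacian_sym : (rel_laplacian R D)^T = rel_laplacian R D.
Proof.
by apply/matrixP => i j; rewrite !mxE eq_sym adj_sym; case: eqVneq => // ->.
Qed.

(** Its rows are orthonormal, so orthonormal vectors on U remain so when extended by zero to all
    vertices. *)
Definition undeleted_incl : 'M[R]_(#|~: D|, #|G|) :=
  rowsub undeleted_index 1%:M.

Lemma rel_laplacianE :
  rel_laplacian R D =
  undeleted_incl *m (laplacian R undeleted
                     + diag_mx (\row_j (deleted_deg (enum_val j))%:R))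
                 *m undeleted_incl^T.
Proof.
have -> : undeleted_incl^T = colsub undeleted_index 1%:M.
  by apply/matrixP => i j; rewrite !mxE eq_sym.
rewrite /undeleted_incl mul_rowsub_mx mulmx_colsub mul1mx mulmx1.
apply/matrixP => i j; rewrite !mxE !(inj_eq undeleted_index_inj).
rewrite !enum_rankK.
case: eqVneq => [->|ij].
  by rewrite deg_split ?enum_val_notin // natrD mulr1n.
by rewrite /= /undeleted_adj !enum_val_notin mulr0n addr0.
Qed.

Lemma undeleted_incl_unitary : map_mx toC undeleted_incl \is unitarymx.
Proof.
apply/unitarymxP/matrixP => i j.
rewrite !mxE (bigD1 (undeleted_index i)) //= big1 => [|l li].
  by rewrite !mxE eqxx mul1r addr0 !rmorph_nat (inj_eq undeleted_index_inj)
             eq_sym.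
by rewrite !mxE eq_sym (negPf li) rmorph0 mul0r.
Qed.

Lemma mxtrace_deleted_le k (W : 'M[R[i]]_(k, #|G|)) : W \is unitarymx ->
  \tr (W *m diag_mx (\row_j (deleted_deg (enum_val j))%:R) *m W^t*)
    <= (\sum_(w in D) minn k #|deleted_nbhd w|)%N%:R.
Proof.
move=> uW; rewrite mxtrace_mul_diag.
set g := fun j => (W^t* *m W) j j.
have -> : \sum_j (\row_j (deleted_deg (enum_val j))%:R) 0 j * (W^t* *m W) j j
   = \sum_(w in D) \sum_j ((enum_val j \in deleted_nbhd w)%:R * g j).
  rewrite exchange_big; apply: eq_bigr => j _.
  by rewrite mxE natr_sum mulr_suml.
(* The weights [g j] over N(w) sum to at most their total k, and to at most |N(w)| because each is
   at most 1. *)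
rewrite natr_sum; apply: ler_sum => w _; rewrite /minn; case: ltnP => _.
  rewrite -(sum_gram_diag uW); apply: ler_sum => j _.
  by case: (_ \in _); rewrite ?mul1r // mul0r gram_diag_ge0.
have -> : #|deleted_nbhd w|%:R
   = \sum_(j < #|G|) (enum_val j \in deleted_nbhd w)%:R :> R[i].
  rewrite -natr_sum; congr (_%:R).
  rewrite -sum1_card big_mkcond (reindex_onto enum_val enum_rank) => [|v _];
    last by rewrite enum_rankK.
  by apply: eq_big => [j|j _]; rewrite ?enum_valK ?eqxx //; case: (_ \in _).
apply: ler_sum => j _.
by case: (_ \in _); rewrite ?mul1r ?gram_diag_le1 // mul0r.
Qed.

Lemma sum_eigenvalues_rel_le k : (k <= #|~: D|)%N ->
  \sum_(i < k) (eigenvalues (rel_laplacian R D))`_i <=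
  \sum_(i < k) (eigenvalues (laplacian R undeleted))`_i +
  (\sum_(w in D) minn k #|deleted_nbhd w|)%N%:R.
Proof.
move=> kU; have [W uW trW] := ky_fan_eq rel_laplacian_sym kU.
rewrite -lecR -trW rel_laplacianE.
have uV := mul_unitarymx uW undeleted_incl_unitary.
set V := W *m _ in uV.
have -> A : W *m map_mx toC (undeleted_incl *m A *m undeleted_incl^T) *m W^t*
        = V *m map_mx toC A *m V^t*.
  have -> : V^t* = map_mx toC undeleted_incl^T *m W^t*.
    rewrite /V trmx_mul map_mxM /=; congr (_ *m _).
    by apply/matrixP => i j; rewrite !mxE rmorph_nat conjC_nat.
  by rewrite /V !map_mxM !mulmxA.
rewrite map_mxD mulmxDr mulmxDl mxtraceD rmorphD rmorph_nat /=.
apply: lerD; first exact: (ky_fan_le (laplacian_sym undeleted)).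
rewrite map_diag_mx; apply: le_trans (mxtrace_deleted_le uV).
rewrite le_eqVlt; apply/orP; left; apply/eqP; congr (\tr (_ *m diag_mx _ *m _)).
by apply/rowP => j; rewrite !mxE rmorph_nat.
Qed.

End Relative.

Theorem theorem4p3p1 (R : realType) :
  (forall X : sgraph,
     majorized (eigenvalues (laplacian R X)) (to_real R (conj_seq (@deg X)))) ->
  forall (G : sgraph) (D : {set G}),
    majorized (eigenvalues (rel_laplacian R D))
              (to_real R (conj_seq (rel_deg D))).
Proof.
move=> GM G D; have sL := rel_laplacian_sym R D.
have size_t (T : finType) (f : T -> nat) : size (to_real R (conj_seq f)) = #|T|.
  by rewrite !size_map size_iota.
have UG : (#|~: D| <= #|G|)%N := max_card _.
rewrite /majorized size_eigenvalues // size_t (maxn_idPr UG).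
(* Past the |U| eigenvalues, only default zeros are added. *)
have sum_s k : (#|~: D| <= k)%N ->
    \sum_(i < k) (eigenvalues (rel_laplacian R D))`_i
    = \tr (rel_laplacian R D).
  move=> Uk; rewrite -sum_eigenvalues // [RHS](big_ord_widen k) //.
  rewrite [LHS](bigID (fun i : 'I_k => i < #|~: D|)%N) /=.
  rewrite [X in _ + X]big1 ?addr0 // => i; rewrite -leqNgt => iU.
  by rewrite nth_default // size_eigenvalues.
have le_U k : (k <= #|~: D|)%N ->
    \sum_(i < k) (eigenvalues (rel_laplacian R D))`_i
    <= \sum_(i < k) (to_real R (conj_seq (rel_deg D)))`_i.
  move=> kU; have kG := leq_trans kU UG.
  apply: le_trans (sum_eigenvalues_rel_le R kU) _.
  rewrite sum_conj_seq // sum_minn_rel_deg natrD lerD2r.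
  have [/(_ k) + _] := GM (undeleted D).
  rewrite sum_conj_seq //; apply.
  by rewrite size_eigenvalues ?laplacian_sym // leq_max kG.
split=> [k kG|].
  have [/le_U //|/ltnW Uk] := leqP k #|~: D|.
  rewrite sum_s // -(sum_s #|~: D|) //; apply: le_trans (le_U _ (leqnn _)) _.
  by rewrite !sum_conj_seq // ler_nat; apply: leq_sum => v _; lia.
rewrite sum_s // sum_conj_seq //.
(* No relative degree exceeds the number of vertices, so the truncation has no effect. *)
have -> : (\sum_v minn #|G| (rel_deg D v) = \sum_v rel_deg D v)%N.
  by apply: eq_bigr => v _; apply/minn_idPr/max_card.
rewrite -sum_deg_undeleted natr_sum /mxtrace.
transitivity (\sum_(i < #|~: D|) (deg (enum_val i))%:R : R).
  by apply: eq_bigr => i _; rewrite !mxE eqxx enum_rankK.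
rewrite -(big_enum_val (fun v => (deg v)%:R : R)) /=.
by apply: eq_bigl => v; rewrite inE.
Qed.
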